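(* Let $X$ be a nonempty Hausdorff topological space and let $W:X\to2^X$ be a compact multifunction with nonempty values. Then $W$ admits (a) a greatest invariant set (with respect to inclusion), and (b) a minimal invariant set, i.e. a minimal element (with respect to inclusion) among the nonempty invariant sets; and these sets are nonempty and compact.
   Context: A multifunction is a map $W:X\to2^X$ into the power set of $X$; $W(S)=\bigcup_{x\in S}W(x)$ for $S\subseteq X$. No continuity of $W$ is assumed. $W$ is compact if $\overline{W(X)}$ is a compact set. The Hutchinson operator induced by $W$ is $\mathcal{F}:2^X\to2^X$, $\mathcal{F}(S)=\overline{W(S)}$. A set $A\subseteq X$ is invariant if $\mathcal{F}(A)=A$. *)

(* Defs.v *)
From mathcomp Require Import all_boot.
From mathcomp Require Import classical_sets topology.

Set Implicit Arguments.
Unset Strict Implicit.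
Unset Printing Implicit Defensive.

Local Open Scope classical_set_scope.

Definition multi_image (X : Type) (W : X -> set X) (S : set X) : set X :=
  \bigcup_(x in S) W x.

(* The values W x need not be closed, nor W continuous: compactness only
   concerns the closure of the total range. *)
Definition compact_multifunction (X : topologicalType) (W : X -> set X) : Prop :=
  compact (closure (multi_image W setT)).

Definition hutchinson (X : topologicalType) (W : X -> set X) (S : set X) :
    set X :=
  closure (multi_image W S).

(* The empty set is always invariant, which is why minimality below is taken
   among the nonempty invariant sets. *)
Definition invariant_set (X : topologicalType) (W : X -> set X) (A : set X) :
    Prop :=
  hutchinson W A = A.

Definition greatest_invariant (X : topologicalType) (W : X -> set X)
    (A : set X) : Prop :=
  invariant_set W A /\ forall B : set X, invariant_set W B -> B `<=` A.

Definition minimal_invariant (X : topologicalType) (W : X -> set X)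
    (A : set X) : Prop :=
  [/\ invariant_set W A, A !=set0 &
      forall B : set X, invariant_set W B -> B !=set0 -> B `<=` A -> B = A].

(* Main.v *)
Require Import Defs.
From mathcomp Require Import all_boot.
From mathcomp Require Import classical_sets topology.
From mathcomp Require Import boolp.

Local Open Scope classical_set_scope.

(** The operator F(S) = closure (W(S)) is monotone, so by Knaster-Tarski the
    union of all S with S `<=` F(S) is its greatest fixed point. For a minimal
    one, order the nonempty closed subsets S of the compact set K = F(X) with
    F(S) `<=` S by reverse inclusion: a chain has a nonempty intersection by
    compactness, so Zorn's lemma gives a minimal such M. As F(M) is again of
    this kind and lies in M, minimality forces F(M) = M. *)

(** A chain of nonempty sets is a base of a proper filter. This filter contains [K], so it clusters
    at some point, which lies in every member because the members are closed. *)
Lemma compact_chain_bigcap (X : topologicalType) (K : set X)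
    (C : set (set X)) :
  compact K -> C !=set0 -> total_on C subset ->
  (forall S, C S -> [/\ closed S, S !=set0 & S `<=` K]) ->
  \bigcap_(S in C) S !=set0.
Proof.
move=> Kcpt [S0 CS0] Ctot CP.
have FF : ProperFilter (filter_from C id).
  apply: filter_from_proper => [|S /CP[]//].
  apply: filter_from_filter => [|S T CS CT]; first by exists S0.
  have [ST|TS] := Ctot _ _ CS CT.
    by exists S => // x Sx; split => //; apply: ST.
  by exists T => // x Tx; split => //; apply: TS.
have [|x [_ Fx]] := Kcpt _ FF; first by exists S0 => //; have [] := CP _ CS0.
exists x => S CS; have [Scl _ _] := CP _ CS.
by apply: Scl => B; apply: Fx; exists S.
Qed.

Section Hutchinson.
Context {X : topologicalType} (W : X -> set X).

Local Notation F := (hutchinson W).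
Local Notation K := (F setT).

Lemma hutchinsonS (A B : set X) : A `<=` B -> F A `<=` F B.
Proof. by move=> AB; apply: closureS; apply: bigcup_subset. Qed.

Lemma closed_hutchinson (A : set X) : closed (F A).
Proof. exact: closed_closure. Qed.

Lemma hutchinson_subT (A : set X) : F A `<=` K.
Proof. exact: hutchinsonS. Qed.

Lemma hutchinson_nonempty (A : set X) :
  (forall x, W x !=set0) -> A !=set0 -> F A !=set0.
Proof.
move=> W0 [x Ax]; have [y Wxy] := W0 x.
by exists y; apply: subset_closure; exists x.
Qed.

Lemma invariant_compact (A : set X) :
  compact_multifunction W -> invariant_set W A -> compact A.
Proof.
move=> Kcpt <-; apply: subclosed_compact Kcpt _; first exact: closed_hutchinson.
exact: hutchinson_subT.
Qed.

Lemma greatest_invariant_exists : exists A, greatest_invariant W A.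
Proof.
pose A := \bigcup_(S in [set S | S `<=` F S]) S.
have AFA : A `<=` F A.
  move=> x [S SFS Sx]; apply: (hutchinsonS S); last exact: SFS.
  by move=> y Sy; exists S.
exists A; split=> [|B FB x Bx]; last by exists B => //=; rewrite FB.
(* Monotonicity turns [AFA] into the same inclusion for [F A], which is therefore one of the sets in
   the union [A]. *)
apply/seteqP; split=> // x FAx; exists (F A) => //.
exact: hutchinsonS.
Qed.

(** The bound by [K] is a separate clause, since subinvariance alone does not confine [S] to [K]. *)
Definition closed_subinvariant (S : set X) : Prop :=
  [/\ closed S, S !=set0, S `<=` K & F S `<=` S].

(** Subinvariance passes to the intersection by monotonicity; compactness serves only to keep it
    nonempty. *)
Lemma closed_subinvariant_bigcap (C : set (set X)) :
  compact_multifunction W -> C !=set0 -> total_on C subset ->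
  C `<=` closed_subinvariant -> closed_subinvariant (\bigcap_(S in C) S).
Proof.
move=> Kcpt C0 Ctot CP; split.
- by apply: closed_bigI => S /CP[].
- by apply: (compact_chain_bigcap X K) => // S /CP[].
- by case: C0 => S CS x /(_ S CS); have [_ _ SK _] := CP _ CS; apply: SK.
- move=> x FIx S CS; have [_ _ _ FS] := CP _ CS.
  by apply/FS/hutchinsonS/FIx => y; apply.
Qed.

Lemma closed_subinvariant_minimal :
  [set: X] !=set0 -> compact_multifunction W -> (forall x, W x !=set0) ->
  exists2 M, closed_subinvariant M &
    forall S, closed_subinvariant S -> S `<=` M -> M `<=` S.
Proof.
move=> X0 Kcpt W0.
have PK : closed_subinvariant K.
  split=> //; first exact: closed_hutchinson.
  - exact: hutchinson_nonempty.
  - exact: hutchinson_subT.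
pose T := {S : set X | closed_subinvariant S}.
pose R (S S' : T) := `[< sval S' `<=` sval S >].
have [||C Ctot|M Mmax] := @ZL_preorder T (exist _ K PK) R.
- by move=> S; apply/asboolP.
- move=> S1 S2 S3 /asboolP S21 /asboolP S32; apply/asboolP.
  exact: subset_trans S32 S21.
(* The empty chain is treated apart: its intersection is all of [X], so [K] serves as the bound
   instead. *)
- have [C0|/set0P/negP] := pselect (C !=set0); last first.
    by rewrite negbK => /eqP ->; exists (exist _ K PK).
  have PI : closed_subinvariant (\bigcap_(S in [set sval S | S in C]) S).
    apply: closed_subinvariant_bigcap => //.
    + by case: C0 => S CS; exists (sval S), S.
    + move=> _ _ [S CS <-] [S' CS' <-].
      (* The alternatives swap because [R] reverses inclusion. *)
      by have [/asboolP|/asboolP] := Ctot _ _ CS CS'; [right|left].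
    + by move=> _ [S _ <-]; apply: svalP.
  exists (exist _ _ PI) => S CS; apply/asboolP => /= x; apply.
  by exists S.
- exists (sval M); first exact: svalP.
  move=> S PS SM; apply/asboolP/(Mmax (exist _ S PS)).
  exact/asboolP.
Qed.

Lemma minimal_invariant_exists :
  [set: X] !=set0 -> compact_multifunction W -> (forall x, W x !=set0) ->
  exists M, minimal_invariant W M.
Proof.
move=> X0 Kcpt W0.
have [M [Mcl M0 MK FM] Mmin] := closed_subinvariant_minimal X0 Kcpt W0.
exists M; split=> // [|B FB B0 BM].
  apply/seteqP; split=> //; apply: Mmin => //; split.
  - exact: closed_hutchinson.
  - exact: hutchinson_nonempty.
  - exact: hutchinson_subT.
  - exact: hutchinsonS.
(* Being equal to [F B], the set [B] is closed and lies in [K], so it competes with [M] in the class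
   where [M] is minimal. *)
apply/seteqP; split=> //; apply: Mmin => //; split=> //.
- by rewrite -FB; apply: closed_hutchinson.
- by rewrite -FB; apply: hutchinson_subT.
- by rewrite FB.
Qed.

End Hutchinson.

Theorem theorem7p4 (X : topologicalType) (W : X -> set X)
    (X_nonempty : [set: X] !=set0)
    (X_hausdorff : hausdorff_space X)
    (W_compact : compact_multifunction W)
    (W_nonempty : forall x : X, W x !=set0) :
  [/\ exists A : set X, greatest_invariant W A,
      exists M : set X, minimal_invariant W M &
      forall A : set X, greatest_invariant W A \/ minimal_invariant W A ->
        A !=set0 /\ compact A].
Proof.
have [M Mmin] := minimal_invariant_exists W X_nonempty W_compact W_nonempty.
split; [exact: greatest_invariant_exists|by exists M|move=> A [[FA Amax]|[FA A0 _]]].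
  split; last exact: invariant_compact FA.
  (* The greatest invariant set inherits a point from the minimal one, which it contains. *)
  by case: Mmin => FM [x Mx] _; exists x; apply: Amax Mx.
by split=> //; apply: invariant_compact FA.
Qed.
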